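(* Let $\mathbb{F}_q$ be the finite field of order $q$, let $m_1,\dots,m_\ell$ be positive integers coprime to $q$, let $n=m_1+\cdots+m_\ell$, and let $\Lambda=(\lambda_1,\dots,\lambda_\ell)$ with all $\lambda_i\in\mathbb{F}_q\setminus\{0\}$. Let $\mathcal{C}=\langle a_1(x),\dots,a_\rho(x)\rangle$ be a $\rho$-generator $\Lambda$-multi-twisted code of length $n$ over $\mathbb{F}_q$, where $a_\kappa(x)=(a_{\kappa,1}(x),\dots,a_{\kappa,\ell}(x))$ for $1\le\kappa\le\rho$. Let $w_i(x)=\gcd(a_{1,i}(x),a_{2,i}(x),\dots,a_{\rho,i}(x),x^{m_i}-\lambda_i)$ for $1\le i\le\ell$. Then the following hold. (a) The parity-check polynomial $h(x)$ of $\mathcal{C}$ is $$h(x)=\operatorname*{lcm}_{1\le i\le\ell}\left[\frac{x^{m_i}-\lambda_i}{w_i(x)}\right].$$ (b) When $\rho=1$, $\dim_{\mathbb{F}_q}\mathcal{C}=\deg h(x)$.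
   Context: Let $V=\prod_{i=1}^{\ell}V_i$ with $V_i=\mathbb{F}_q[x]/\langle x^{m_i}-\lambda_i\rangle$, an $\mathbb{F}_q[x]$-module; $\mathbb{F}_q^n$ is identified with $V$ by sending $(a_{1,0},\dots,a_{1,m_1-1};\dots;a_{\ell,0},\dots,a_{\ell,m_\ell-1})$ to $(a_1(x),\dots,a_\ell(x))$ with $a_i(x)=\sum_{j=0}^{m_i-1}a_{i,j}x^j$. A $\Lambda$-multi-twisted code of length $n$ over $\mathbb{F}_q$ is an $\mathbb{F}_q[x]$-submodule of $V$. It is called a $\rho$-generator code if $\rho$ is the smallest positive integer such that there are $\rho$ codewords $a_1(x),\dots,a_\rho(x)\in\mathcal{C}$ generating $\mathcal{C}$ as an $\mathbb{F}_q[x]$-module; one writes $\mathcal{C}=\langle a_1(x),\dots,a_\rho(x)\rangle$. The annihilator of $\mathcal{C}$ is the ideal $\mathrm{Ann}(\mathcal{C})=\{f(x)\in\mathbb{F}_q[x]: f(x)a_\kappa(x)=0 \text{ in } V \text{ for } 1\le\kappa\le\rho\}$ of $\mathbb{F}_q[x]$, and the parity-check polynomial of $\mathcal{C}$ is the unique monic polynomial $h(x)$ of smallest degree in it, i.e. its monic generator. Gcds and lcms are taken monic. *)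

(* Defs.v *)
From HB Require Import structures.
From mathcomp Require Import all_boot all_order all_algebra.
Set Implicit Arguments.
Unset Strict Implicit.
Unset Printing Implicit Defensive.
Import GRing.Theory VectorInternalTheory.
Local Open Scope ring_scope.

(* The library has products of a constant family of vector spaces
   ({ffun I -> vT}) but not of a dependent one. *)
Definition vprod (K : fieldType) (l : nat) (T : 'I_l -> vectType K) : Type :=
  {dffun forall i : 'I_l, T i}.

Section VProd.
Variables (K : fieldType) (l : nat) (T : 'I_l -> vectType K).
Local Notation V := (vprod T).
Implicit Types u v w : V.

HB.instance Definition _ := Choice.copy V {dffun forall i : 'I_l, T i}.

Definition vprod_mk (f : forall i, T i) : V := [ffun i => f i].

Lemma vprodE f i : vprod_mk f i = f i. Proof. exact: ffunE. Qed.

Lemma vprodP u v : (forall i, u i = v i) <-> u = v.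
Proof. exact: ffunP. Qed.

Definition vprod_zero : V := vprod_mk (fun=> 0).
Definition vprod_opp v : V := vprod_mk (fun i => - v i).
Definition vprod_add u v : V := vprod_mk (fun i => u i + v i).
Definition vprod_scale (c : K) v : V := vprod_mk (fun i => c *: v i).

Fact vprod_addA : associative vprod_add.
Proof. by move=> u v w; apply/vprodP=> i; rewrite !vprodE addrA. Qed.
Fact vprod_addC : commutative vprod_add.
Proof. by move=> u v; apply/vprodP=> i; rewrite !vprodE addrC. Qed.
Fact vprod_add0 : left_id vprod_zero vprod_add.
Proof. by move=> u; apply/vprodP=> i; rewrite !vprodE add0r. Qed.
Fact vprod_addN : left_inverse vprod_zero vprod_opp vprod_add.
Proof. by move=> u; apply/vprodP=> i; rewrite !vprodE addNr. Qed.

HB.instance Definition _ :=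
  GRing.isZmodule.Build V vprod_addA vprod_addC vprod_add0 vprod_addN.

Fact vprod_scaleA a b v :
  vprod_scale a (vprod_scale b v) = vprod_scale (a * b) v.
Proof. by apply/vprodP=> i; rewrite !vprodE scalerA. Qed.
Fact vprod_scale1 : left_id 1 vprod_scale.
Proof. by move=> v; apply/vprodP=> i; rewrite !vprodE scale1r. Qed.
Fact vprod_scaleDr : right_distributive vprod_scale +%R.
Proof. by move=> a u v; apply/vprodP=> i; rewrite !vprodE scalerDr. Qed.
Fact vprod_scaleDl v : {morph vprod_scale^~ v : a b / a + b}.
Proof. by move=> a b; apply/vprodP=> i; rewrite !vprodE scalerDl. Qed.

HB.instance Definition _ := GRing.Zmodule_isLmodule.Build K V
  vprod_scaleA vprod_scale1 vprod_scaleDr vprod_scaleDl.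

Lemma vprod0E i : (0 : V) i = 0. Proof. exact: vprodE. Qed.
Lemma vprodDE u v i : (u + v) i = u i + v i. Proof. exact: vprodE. Qed.
Lemma vprodZE c v i : (c *: v) i = c *: v i. Proof. exact: vprodE. Qed.

Fact vprod_vect_iso : Vector.axiom (\sum_i dim (T i)) V.
Proof.
exists (fun v : V => \mxrow_i v2r (v i)).
  by move=> a u v; apply/rowP=> j; rewrite !mxE vprodDE vprodZE linearP !mxE.
exists (fun r => vprod_mk (fun i => r2v (submxrow r i))) => [v|r].
  by apply/vprodP=> i; rewrite vprodE mxrowK v2rK.
by apply/mxrowP=> i; rewrite mxrowK vprodE r2vK.
Qed.

HB.instance Definition _ := Lmodule_hasFinDim.Build K V vprod_vect_iso.

Lemma dim_vprod : \dim (fullv : {vspace V}) = \sum_i dim (T i).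
Proof. by rewrite dimvf. Qed.

End VProd.

Section MultiTwisted.
Variables (F : finFieldType) (l : nat) (m : 'I_l -> nat) (lam : 'I_l -> F).

Definition mt_modulus (i : 'I_l) : {poly F} := 'X^(m i) - (lam i)%:P.

(* {poly %/ p} is F[x]/<p> only for p monic of positive degree (otherwise the
   library replaces p by 'X), so this is the intended space when every m i is
   positive; its elements are the reduced representatives. *)
Definition mt_space := vprod (fun i => ({poly %/ mt_modulus i} : vectType F)).
HB.instance Definition _ := Vector.on mt_space.

Definition mt_coord (v : mt_space) (i : 'I_l) : {poly %/ mt_modulus i} := v i.

Definition mt_act (f : {poly F}) (v : mt_space) : mt_space :=
  vprod_mk (T := fun i => ({poly %/ mt_modulus i} : vectType F))
    (fun i => in_qpoly (mt_modulus i) f * mt_coord v i).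

(* An F[x]-submodule is in particular an F-subspace, so it is represented as a
   subspace stable under the action of F[x]. *)
Definition mt_code (C : {vspace mt_space}) : Prop :=
  forall f v, v \in C -> mt_act f v \in C.

Definition mt_generates r (a : 'I_r -> mt_space) (C : {vspace mt_space}) :=
  forall v, v \in C <->
    exists f : 'I_r -> {poly F}, v = \sum_(k < r) mt_act (f k) (a k).

Definition mt_rho_generator (rho : nat) (C : {vspace mt_space}) : Prop :=
  [/\ mt_code C, (0 < rho)%N,
      exists a : 'I_rho -> mt_space, mt_generates a C
    & forall r (b : 'I_r -> mt_space),
        (0 < r)%N -> mt_generates b C -> (rho <= r)%N].

Definition mt_ann r (a : 'I_r -> mt_space) (f : {poly F}) : Prop :=
  forall k, mt_act f (a k) = 0.

Definition parity_check_poly r (a : 'I_r -> mt_space) (h : {poly F}) : Prop :=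
  [/\ h \is monic, mt_ann a h
    & forall g, g \is monic -> mt_ann a g -> (size h <= size g)%N].

Section Facts.
Hypothesis m_gt0 : forall i, (0 < m i)%N.

Lemma mk_monic_mt_modulus i : mk_monic (mt_modulus i) = mt_modulus i.
Proof.
by rewrite /mk_monic /mt_modulus size_XnsubC ?m_gt0 // monicXnsubC ?m_gt0 // ltnS m_gt0.
Qed.

Lemma dim_mt_space : \dim (fullv : {vspace mt_space}) = (\sum_i m i)%N.
Proof.
rewrite dim_vprod; apply: eq_bigr => i _.
have -> : dim {poly %/ mt_modulus i} = (size (mk_monic (mt_modulus i))).-1 by [].
by rewrite mk_monic_mt_modulus size_XnsubC ?m_gt0.
Qed.

End Facts.

Lemma mt_actC c v : mt_act c%:P v = c *: v.
Proof.
apply/vprodP=> i; rewrite !vprodE -alg_polyC linearZ /= in_qpoly1.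
by rewrite -scalerAl mul1r.
Qed.

Lemma mt_actM f g v : mt_act (f * g) v = mt_act f (mt_act g v).
Proof.
by apply/vprodP=> i; rewrite /mt_act !vprodE in_qpolyM -mulrA /mt_coord vprodE.
Qed.

End MultiTwisted.

(* gcdp is only determined up to a unit; the following are the monic gcd and
   lcm, with value 0 when the gcd (resp. lcm) is 0. *)
Section MonicGcd.
Variable F : fieldType.
Implicit Types p q r : {poly F}.

Definition monic_assoc p : {poly F} := (lead_coef p)^-1 *: p.
Definition mgcdp p q : {poly F} := monic_assoc (gcdp p q).
Definition mlcmp p q : {poly F} := monic_assoc (p * q %/ gcdp p q).

Lemma monic_assoc_monic p : p != 0 -> monic_assoc p \is monic.
Proof.
move=> p0; rewrite monicE /monic_assoc lead_coefZ mulVf //.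
by rewrite lead_coef_eq0.
Qed.

Lemma monic_assoc_eqp p : monic_assoc p %= p.
Proof.
have [->|p0] := eqVneq p 0; first by rewrite /monic_assoc scaler0 eqpxx.
by apply: eqp_scale; rewrite invr_eq0 lead_coef_eq0.
Qed.

Lemma dvdp_mgcdp r p q : (r %| mgcdp p q) = (r %| p) && (r %| q).
Proof. by rewrite (eqp_dvdr _ (monic_assoc_eqp _)) dvdp_gcd. Qed.

Lemma mlcmp_dvdp r p q : (mlcmp p q %| r) = (p %| r) && (q %| r).
Proof.
rewrite (eqp_dvdl _ (monic_assoc_eqp _)).
have [g0|g0] := eqVneq (gcdp p q) 0.
  move/eqP: g0; rewrite gcdp_eq0 => /andP[/eqP -> /eqP ->].
  by rewrite mul0r div0p andbb.
have gpq : gcdp p q %| p * q by rewrite dvdp_mulr ?dvdp_gcdl.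
rewrite -(dvdp_mul2r _ _ g0) divpK //.
rewrite (eqp_dvdr _ (mulp_gcdr _ _ _)) dvdp_gcd.
have [p0|p0] := eqVneq p 0.
  have q0 : q != 0 by move: g0; rewrite p0 gcd0p.
  rewrite p0 mul0r mulr0 dvdpp !dvd0p mulf_eq0 (negPf q0) orbF /=.
  by case: eqP => //= ->; rewrite dvdp0.
have [q0|q0] := eqVneq q 0.
  rewrite q0 !mulr0 dvdpp !dvd0p mulf_eq0 (negPf p0) orbF andbT andbC.
  by case: eqP => //= ->; rewrite dvdp0.
by rewrite [p * q]mulrC dvdp_mul2r // mulrC dvdp_mul2r // andbC.
Qed.

End MonicGcd.

(* Main.v *)
(* A polynomial f annihilates the a_k iff x^(m_i) - lam_i divides
   f * gcd_k a_(k,i), hence f * w_i, for every i; equivalently, iff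
   (x^(m_i) - lam_i) / w_i divides f for every i, i.e. iff the lcm divides f.
   So Ann(C) is the ideal generated by the lcm.  If C = <a_1>, then
   f |-> f a_1 induces a linear isomorphism from the polynomials of degree
   < deg h onto C. *)

Require Import Defs.
From HB Require Import structures.
From mathcomp Require Import all_boot all_order all_algebra.
Set Implicit Arguments.
Unset Strict Implicit.
Unset Printing Implicit Defensive.
Import GRing.Theory.
Local Open Scope ring_scope.

(** Multiplication by [f] distributes over gcds up to a unit, and a gcd is divisible by [M] iff both
    arguments are. The empty gcd 0 matches the empty conjunction, since [M] divides 0. *)
Lemma dvdp_big_mgcdp (F : fieldType) (I : Type) (s : seq I) (p : I -> {poly F})
    (f M : {poly F}) :
  (M %| f * \big[@mgcdp F/0]_(k <- s) p k) = all (fun k => M %| f * p k) s.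
Proof.
elim: s => [|k s IHs]; first by rewrite big_nil mulr0 dvdp0.
rewrite big_cons /= -IHs.
rewrite (eqp_dvdr _ (eqp_mull f (monic_assoc_eqp _))).
by rewrite (eqp_dvdr _ (mulp_gcdr _ _ _)) dvdp_gcd.
Qed.

(** The second argument of the gcd only adds the condition that [M] divides [f * M], which always
    holds. *)
Lemma dvdp_mul_mgcdp (F : fieldType) (f p M : {poly F}) :
  (M %| f * mgcdp p M) = (M %| f * p).
Proof.
rewrite (eqp_dvdr _ (eqp_mull f (monic_assoc_eqp _))).
by rewrite (eqp_dvdr _ (mulp_gcdr _ _ _)) dvdp_gcd dvdp_mulIr andbT.
Qed.

Lemma big_mlcmp_dvdp (F : fieldType) (I : Type) (s : seq I) (p : I -> {poly F})
    (f : {poly F}) :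
  (\big[@mlcmp F/1]_(i <- s) p i %| f) = all (fun i => p i %| f) s.
Proof.
elim: s => [|i s IHs]; first by rewrite big_nil dvd1p.
by rewrite big_cons mlcmp_dvdp IHs.
Qed.

Lemma mlcmp_monic (F : fieldType) (p q : {poly F}) :
  p != 0 -> q != 0 -> mlcmp p q \is monic.
Proof.
move=> p0 q0; apply: monic_assoc_monic.
have gpq : gcdp p q %| p * q by rewrite dvdp_mulr // dvdp_gcdl.
have : p * q != 0 by rewrite mulf_neq0.
by rewrite -{1}(divpK gpq) mulf_eq0 negb_or => /andP[].
Qed.

Lemma big_mlcmp_monic (F : fieldType) (I : Type) (s : seq I)
    (p : I -> {poly F}) :
  (forall i, p i != 0) -> \big[@mlcmp F/1]_(i <- s) p i \is monic.
Proof.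
move=> p0; elim: s => [|i s IHs]; first by rewrite big_nil monic1.
by rewrite big_cons mlcmp_monic // monic_neq0.
Qed.

(** As [v] is its own reduced representative, the product is the class of [f * v], whose
    representative is a remainder modulo [mk_monic M]. *)
Lemma in_qpoly_mul_eq0 (F : fieldType) (M f : {poly F}) (v : {poly %/ M}) :
  (in_qpoly M f * v == 0) = (mk_monic M %| f * v).
Proof.
have vE : in_qpoly M v = v by exact/val_inj/in_qpoly_small/size_mk_monic.
rewrite -[X in _ * X]vE -in_qpolyM -val_eqE /=.
by rewrite -Pdiv.IdomainMonic.modpE ?monic_mk_monic.
Qed.

Section MultiTwistedTheory.
Variables (F : finFieldType) (l : nat) (m : 'I_l -> nat) (lam : 'I_l -> F).
Hypothesis m_gt0 : forall i, (0 < m i)%N.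
Implicit Types (f g h : {poly F}) (v : mt_space m lam).

Lemma mt_actDl f g v : mt_act (f + g) v = mt_act f v + mt_act g v.
Proof. by apply/vprodP=> i; rewrite vprodDE !vprodE in_qpolyD mulrDl. Qed.

Lemma mt_act_eq0P f v :
  (mt_act f v = 0) <-> (forall i, mt_modulus m lam i %| f * mt_coord v i).
Proof.
split=> [/vprodP fv0 i | Mfv]; last apply/vprodP=> i.
  move: (fv0 i); rewrite vprodE vprod0E => /eqP.
  (* Positivity of [m i] is what makes [mk_monic] leave the modulus unchanged. *)
  by rewrite in_qpoly_mul_eq0 [X in X %| _]mk_monic_mt_modulus.
rewrite vprodE vprod0E; apply/eqP.
by rewrite in_qpoly_mul_eq0 [X in X %| _]mk_monic_mt_modulus.
Qed.

Section Generators.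
Variables (r : nat) (a : 'I_r -> mt_space m lam).

Let w i : {poly F} :=
  mgcdp (\big[@mgcdp F/0]_(k < r) mt_coord (a k) i) (mt_modulus m lam i).
Let H : {poly F} := \big[@mlcmp F/1]_(i < l) (mt_modulus m lam i %/ w i).

Let modulus_neq0 i : mt_modulus m lam i != 0.
Proof. by rewrite monic_neq0 ?monicXnsubC. Qed.

Let w_dvd i : w i %| mt_modulus m lam i.
Proof. by rewrite (eqp_dvdl _ (monic_assoc_eqp _)) dvdp_gcdr. Qed.

Let w_neq0 i : w i != 0.
Proof. exact: dvdpN0 (w_dvd i) (modulus_neq0 i). Qed.

Let cofactor_neq0 i : mt_modulus m lam i %/ w i != 0.
Proof.
have := modulus_neq0 i.
by rewrite -{1}(divpK (w_dvd i)) mulf_eq0 negb_or => /andP[].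
Qed.

(** Multiplying both sides by the nonzero [w i] clears the quotient; the gcd in [w i] then splits
    into one condition per generator. *)
Let cofactor_dvdp f i : (mt_modulus m lam i %/ w i %| f) =
  all (fun k => mt_modulus m lam i %| f * mt_coord (a k) i) (index_enum 'I_r).
Proof.
rewrite -(dvdp_mul2r _ _ (w_neq0 i)) divpK //.
by rewrite dvdp_mul_mgcdp dvdp_big_mgcdp.
Qed.

Lemma mt_annP f : mt_ann a f <-> H %| f.
Proof.
rewrite big_mlcmp_dvdp; split=> [af0|/allP Hf k].
  apply/allP=> i _; rewrite cofactor_dvdp; apply/allP=> k _.
  by have /mt_act_eq0P/(_ i) := af0 k.
apply/mt_act_eq0P=> i; have := Hf i (mem_index_enum i).
by rewrite cofactor_dvdp => /allP/(_ k); apply; rewrite mem_index_enum.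
Qed.

Lemma parity_check_polyP h : parity_check_poly a h <-> h = H.
Proof.
have H_monic : H \is monic by apply: big_mlcmp_monic.
split=> [[h_monic /mt_annP Hh h_min]|->].
  have hH : (size h <= size H)%N by apply: h_min => //; apply/mt_annP.
  (* [H] divides [h] and minimality bounds the size of [h], so the two are associated; monic
     associates are equal. *)
  apply/esym/eqP; rewrite -eqp_monic // -dvdp_size_eqp // eqn_leq hH andbT.
  by rewrite dvdp_leq ?monic_neq0.
split=> // [|g g_monic /mt_annP Hg]; first exact/mt_annP.
by rewrite dvdp_leq ?monic_neq0.
Qed.

End Generators.

Lemma dim_cyclic_mt_code (C : {vspace mt_space m lam})
    (a : 'I_1 -> mt_space m lam) h :
  mt_generates a C -> parity_check_poly a h -> \dim C = (size h).-1.
Proof.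
move=> aC ha; have /parity_check_polyP hH := ha.
have annP f : mt_act f (a ord0) = 0 <-> h %| f.
  rewrite hH; split=> [fa0 | /mt_annP]; last exact.
  by apply/mt_annP=> k; rewrite ord1.
have h0 : h != 0 by case: ha => /monic_neq0.
pose d := (size h).-1.
have size_h : size h = d.+1 by rewrite prednK // size_poly_gt0.
(* [{poly_d F}] consists of the polynomials of size at most [d], that is, of degree less than the
   degree of [h]. *)
pose phi (p : {poly_d F}) : mt_space m lam := mt_act p (a ord0).
have phi_lin : linear phi.
  move=> c p p'; rewrite /phi.
  have -> : polyn (c *: p + p') = c%:P * polyn p + polyn p'.
    by rewrite mul_polyC.
  by rewrite mt_actDl mt_actM mt_actC.
pose phiL := GRing.isLinear.Build _ _ _ _ phi phi_lin.
pose Phi : {linear {poly_d F} -> mt_space m lam} := HB.pack phi phiL.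
pose L := linfun Phi.
have ker0 : lker L = 0%VS.
  apply/eqP; rewrite -subv0; apply/subvP=> p.
  rewrite memv_ker lfunE /= memv0 => /eqP/annP hp.
  (* Injectivity: [h] has size [d.+1], so it divides no nonzero polynomial of size at most [d]. *)
  rewrite -val_eqE /=; apply: contraLR hp => p0.
  by rewrite gtNdvdp // size_h ltnS size_npoly.
have -> : C = limg L.
  apply/vspaceP=> v; apply/idP/idP.
    move=> /aC[f ->]; rewrite big_ord1.
    (* Surjectivity: the remainder of the coefficient modulo [h] is a preimage, because the multiple
       of [h] split off by Euclidean division kills the generator. *)
    have fh_small : (size (f ord0 %% h)%R <= d)%N.
      by rewrite -ltnS -size_h ltn_modp.
    apply/memv_imgP; exists (NPoly fh_small); rewrite ?memvf // lfunE /= /phi /=.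
    rewrite {1}(divp_eq (f ord0) h) mt_actDl.
    by rewrite (_ : mt_act _ _ = 0) ?add0r //; apply/annP; rewrite dvdp_mull.
  move=> /memv_imgP[p _ ->]; apply: (proj2 (aC _)); exists (fun=> polyn p).
  by rewrite big_ord1 lfunE.
(* Rank-nullity with trivial kernel; the source has dimension [d]. *)
have := limg_ker_dim L fullv.
by rewrite ker0 capv0 dimv0 add0n dim_polyn.
Qed.

End MultiTwistedTheory.

Theorem theorem5p1 (F : finFieldType) (q : nat) (hq : #|F| = q)
  (l : nat) (hl : (0 < l)%N) (m : 'I_l -> nat)
  (m_gt0 : forall i, (0 < m i)%N) (m_coprime : forall i, coprime (m i) q)
  (n : nat) (hn : n = (\sum_(i < l) m i)%N)
  (lam : 'I_l -> F) (lam_neq0 : forall i, lam i != 0)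
  (rho : nat) (C : {vspace mt_space m lam}) (a : 'I_rho -> mt_space m lam)
  (hC : mt_rho_generator rho C) (ha : mt_generates a C) :
  let w i : {poly F} :=
    mgcdp (\big[@mgcdp F/0]_(k < rho) mt_coord (a k) i) ('X^(m i) - (lam i)%:P) in
  (forall h : {poly F}, parity_check_poly a h <->
     h = \big[@mlcmp F/1]_(i < l) (('X^(m i) - (lam i)%:P) %/ w i)) /\
  (rho = 1%N -> forall h : {poly F}, parity_check_poly a h ->
     \dim C = (size h).-1).
Proof.
move=> w; split=> [h|rho1 h]; first exact: parity_check_polyP.
by subst rho; apply: dim_cyclic_mt_code.
Qed.
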